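(* For every $\varepsilon > 0$, the function $f(p) = 2p$ has a fast simulation on $[0, 1/2 - \varepsilon]$.
   Context: For $p\in[0,1]$ let $\mathbf{P}_p$ be the law of an infinite sequence $X_1,X_2,\ldots$ of i.i.d. $\{0,1\}$-valued random variables (''$p$-coin tosses'') with $\mathbf{P}_p(X_i=1)=p$. An algorithm consists of a stopping time $N$ (values in $\{0,1,2,\ldots\}\cup\{\infty\}$) with respect to the natural filtration of $(X_i)_{i\ge1}$, and a $\{0,1\}$-valued output which, on $\{N<\infty\}$, is a function of $(X_1,\ldots,X_N)$ only; no randomness other than the tosses is used, and the algorithm does not depend on $p$. $N$ is the number of inputs needed. The algorithm simulates a function $f:S\to[0,1]$ on $S\subset[0,1]$ if for every $p\in S$ we have $\mathbf{P}_p(N<\infty)=1$ and $\mathbf{P}_p(\text{output}=1)=f(p)$. A function $f$ has a fast simulation on $S$ if there exists an algorithm which simulates $f$ on $S$ such that for every $p\in S$ there exist constants $C>0$, $\rho<1$ (which may depend on $p$) with $\mathbf{P}_p(N>n)\le C\rho^n$ for all $n$. *)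

(* Defs.v *)
From HB Require Import structures.
From mathcomp Require Import all_boot all_order all_algebra.
From mathcomp Require Import finmap ring.
From mathcomp Require Import all_classical all_reals all_analysis.
From mathcomp Require Import measurable_realfun.

Set Implicit Arguments.
Unset Strict Implicit.
Unset Printing Implicit Defensive.

Import Order.TTheory GRing.Theory Num.Theory.
Import numFieldNormedType.Exports.

Local Open Scope classical_set_scope.
Local Open Scope ring_scope.

Definition toss_events : set (set (nat -> bool)) :=
  \bigcup_i preimage_set_system setT (fun w : nat -> bool => w i) measurable.

(* {0,1}^N with the product sigma-algebra; the toss X_(i+1) is the
   coordinate w i *)
Definition tosses := g_sigma_algebraType toss_events.

Definition toss (i : nat) (w : tosses) : bool := w i.

Definition mutually_independent (R : realType) (d d' : measure_display)
    (T : measurableType d) (T' : measurableType d')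
    (P : probability T R) (X : nat -> T -> T') : Prop :=
  forall (J : {fset nat}) (B : nat -> set T'),
    (forall i, measurable (B i)) ->
    P (\bigcap_(i in [set` J]) X i @^-1` B i) =
    (\prod_(i <- J) P (X i @^-1` B i))%E.

(* P is the law of an i.i.d. sequence of p-coin tosses; this determines P, and
   such a P exists for each p in [0, 1] by coin_law_exists below *)
Definition coin_law (R : realType) (p : R) (P : probability tosses R) : Prop :=
  mutually_independent P toss /\
  forall i, P [set w | toss i w = true] = p%:E.

(* sigma(X_1, ..., X_n) *)
Definition toss_filtration (n : nat) : set (set tosses) :=
  g_sigma_preimage (fun i : 'I_n => toss i).

(* None is the value oo *)
Definition stopping_time (N : tosses -> option nat) : Prop :=
  forall n, toss_filtration n [set w | N w = Some n].

(* the output on {N = n} is alg_decide [:: X_1; ...; X_n]; nothing is output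
   on {N = oo} *)
Record algorithm := Algorithm {
  alg_time : tosses -> option nat;
  alg_timeP : stopping_time alg_time;
  alg_decide : seq bool -> bool }.

Definition halts (A : algorithm) : set tosses :=
  [set w | exists n, alg_time A w = Some n].

Definition outputs1 (A : algorithm) : set tosses :=
  [set w | exists2 n, alg_time A w = Some n &
           alg_decide A (mkseq (toss ^~ w) n) = true].

(* the event N > n, which contains {N = oo} *)
Definition runs_past (A : algorithm) (n : nat) : set tosses :=
  [set w | if alg_time A w is Some k then (n < k)%N else true].

(* Meant for S contained in [0, 1] and f with values in [0, 1] on S: no P
   satisfies coin_law p P when p lies outside [0, 1]. *)
Definition simulates (R : realType) (A : algorithm) (S : set R) (f : R -> R) :
    Prop :=
  forall p, S p -> forall P : probability tosses R, coin_law p P ->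
    P (halts A) = 1%E /\ P (outputs1 A) = (f p)%:E.

Definition has_fast_simulation (R : realType) (S : set R) (f : R -> R) : Prop :=
  exists A : algorithm, simulates A S f /\
    forall p, S p -> exists C rho : R, [/\ 0 < C, rho < 1 &
      forall P : probability tosses R, coin_law p P ->
      forall n, (P (runs_past A n) <= (C * rho ^+ n)%:E)%E].

Section coin_law_exists.
Variables (R : realType) (p : R).
Hypothesis p01 : 0 <= p <= 1.

Let mu := @lebesgue_measure R.

(* The digits of a point of [0, 1[ when intervals are split in the
   proportions p : 1 - p. *)
Let next (u : R) : R := if u < p then u / p else (u - p) / (1 - p).
Let digit (i : nat) (u : R) : bool := iter i next u < p.
Let digits (u : R) : tosses := fun i => digit i u.

Let weight (B : set bool) : R :=
  (if true \in B then p else 0) + (if false \in B then 1 - p else 0).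

Let measurable_next : measurable_fun setT next.
Proof.
apply: measurable_fun_ifT.
- exact: measurable_fun_ltr.
- exact: measurable_funM.
- by apply: measurable_funM => //; apply: measurable_funB.
Qed.

Let measurable_digit i : measurable_fun setT (digit i).
Proof.
apply: measurable_fun_ltr => //.
elim: i => [|i IHi] /=; first exact: measurable_id.
exact: measurableT_comp.
Qed.

Let measurable_digits : measurable_fun setT digits.
Proof.
apply: (@measurability _ _ _ _ setT digits toss_events) => //.
move=> _ [_ [i _ [B mB <-]] <-]; rewrite setTI.
by rewrite setTI -[X in measurable X]setTI; exact: measurable_digit.
Qed.

Let cell (B : nat -> set bool) n (a l : R) : set R :=
  [set u | [/\ a <= u, u < a + l &
    forall i, (i < n)%N -> B i (digit i ((u - a) / l))]].

Let measurable_cell B n a l : measurable (cell B n a l).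
Proof.
have -> : cell B n a l = `[a, a + l[%classic `&`
    \bigcap_(i in [set i | (i < n)%N])
      ((fun u => digit i ((u - a) / l)) @^-1` B i).
  apply/seteqP; split => [u [h1 h2 h3]|u [/=]].
    by split; [rewrite /= in_itv /= h1 h2|move=> i; exact: h3].
  by rewrite in_itv /= => /andP[h1 h2] h3; split=> // i; exact: h3.
apply: measurableI => //; apply: bigcap_measurableType => // i _.
rewrite -[X in measurable X]setTI.
have : measurable_fun setT (fun u : R => digit i ((u - a) / l)).
  apply: (measurableT_comp (measurable_digit i)).
  by apply: measurable_funM => //; apply: measurable_funB.
by apply.
Qed.

Let mu_cell n : forall B a l, 0 <= l ->
  mu (cell B n a l) = (l * \prod_(i < n) weight (B i))%:E.
Proof.
have /andP[p0 p1] := p01.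
elim: n => [|n IHn] B a l l0.
  rewrite big_ord0 mulr1.
  have -> : cell B 0 a l = `[a, a + l[%classic.
    apply/seteqP; split => [u [h1 h2 _]|u /=]; rewrite /= in_itv /=.
      by rewrite h1 h2.
    by move=> /andP[h1 h2]; split.
  rewrite /mu lebesgue_measure_itv /= lte_fin; case: ltP => h.
    by rewrite -EFinD; congr EFin; rewrite addrC addKr.
  by congr EFin; apply/eqP; rewrite eq_le l0 /= -(lerD2l a) addr0.
pose B' i := B i.+1.
pose C1 := if true \in B 0%N then cell B' n a (p * l) else set0.
pose C0 :=
  if false \in B 0%N then cell B' n (a + p * l) ((1 - p) * l) else set0.
have E : cell B n.+1 a l = C1 `|` C0.
  have dig u : 0 < l -> a <= u -> u < a + l ->
      [/\ u < a + p * l -> digit 0 ((u - a) / l) = true,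
          a + p * l <= u -> digit 0 ((u - a) / l) = false,
          u < a + p * l -> forall i,
            digit i.+1 ((u - a) / l) = digit i ((u - a) / (p * l)) &
          a + p * l <= u -> forall i, digit i.+1 ((u - a) / l) =
            digit i ((u - (a + p * l)) / ((1 - p) * l))].
    move=> lt0 au ual.
    have d0 : digit 0 ((u - a) / l) = (u < a + p * l).
      by rewrite /digit /= ltr_pdivrMr // ltrBlDl.
    split.
    - by rewrite d0.
    - by rewrite d0 => /le_gtF.
    - move=> h i; rewrite /digit iterSr {2}/next.
      move: d0; rewrite /digit /= h => ->; congr (iter _ _ _ < _).
      by rewrite invfM mulrA mulrAC.
    - move=> h i; rewrite /digit iterSr {2}/next.
      move: d0; rewrite /digit /= (le_gtF h) => ->; congr (iter _ _ _ < _).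
      rewrite invfM [RHS]mulrCA [RHS]mulrC; congr (_ / _).
      by field; rewrite gt_eqF.
  apply/seteqP; split => [u [au ual Bu]|u].
    have lt0 : 0 < l by rewrite -(ltrD2l a) addr0; exact: le_lt_trans ual.
    have [d1 d0 dS1 dS0] := dig u lt0 au ual.
    have := Bu 0%N isT; case: (ltP u (a + p * l)) => h.
      rewrite d1 // => B1; left; rewrite /C1 mem_set //; split => // i ni.
      by rewrite -dS1 //; exact: Bu.
    rewrite d0 // => B0; right; rewrite /C0 mem_set //; split => //.
      by rewrite -addrA -mulrDl [p + _]addrC subrK mul1r.
    by move=> i ni; rewrite -dS0 //; exact: Bu.
  have pl0 : 0 <= p * l by exact: mulr_ge0.
  have pll : p * l <= l by rewrite ler_piMl.
  case.
    rewrite /C1; case: ifPn => // /set_mem B1 [au h Bu].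
    have ual : u < a + l by apply: lt_le_trans h _; rewrite lerD2l.
    have lt0 : 0 < l by rewrite -(ltrD2l a) addr0; exact: le_lt_trans ual.
    have [d1 _ dS1 _] := dig u lt0 au ual.
    by split=> // -[_|i ni]; [rewrite d1|rewrite dS1 //; exact: Bu].
  rewrite /C0; case: ifPn => // /set_mem B0 [h ual0 Bu].
  have ual : u < a + l.
    by move: ual0; rewrite -addrA -mulrDl [p + _]addrC subrK mul1r.
  have au : a <= u by apply: le_trans h; rewrite lerDl.
  have lt0 : 0 < l by rewrite -(ltrD2l a) addr0; exact: le_lt_trans ual.
  have [_ d0 _ dS0] := dig u lt0 au ual.
  by split=> // -[_|i ni]; [rewrite d0|rewrite dS0 //; exact: Bu].
have mC1 : measurable C1 by rewrite /C1; case: ifP.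
have mC0 : measurable C0 by rewrite /C0; case: ifP.
have dC : C1 `&` C0 = set0.
  apply/seteqP; split => // u [].
  rewrite /C1 /C0; case: ifP => // _ [_ h _]; case: ifP => // _ [h' _ _].
  by move: h; rewrite ltNge h'.
rewrite E; transitivity (mu C1 + mu C0)%E.
  exact: (measureU lebesgue_measure mC1 mC0 dC).
rewrite big_ord_recl /=.
have mu0 : mu set0 = 0%E by exact: (measure0 lebesgue_measure).
have -> : mu C1 = ((if true \in B 0%N then p else 0) * l *
    \prod_(i < n) weight (B' i))%:E.
  rewrite /C1; case: ifP => _; last by rewrite mu0 !mul0r.
  by rewrite IHn // mulr_ge0.
have -> : mu C0 = ((if false \in B 0%N then 1 - p else 0) * l *
    \prod_(i < n) weight (B' i))%:E.
  rewrite /C0; case: ifP => _; last by rewrite mu0 !mul0r.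
  by rewrite IHn // mulr_ge0 // subr_ge0.
by rewrite -EFinD -!mulrDl -/(weight _) mulrA [_ * l]mulrC.
Qed.

Let I01 := `[0 : R, 1[%classic.
Let mI01 : measurable I01. Proof. exact: measurable_itv. Qed.

Definition coin_prob (A : set tosses) : \bar R :=
  mrestr mu mI01 (digits @^-1` A).

Let law0 : coin_prob set0 = 0%E.
Proof. by rewrite /coin_prob preimage_set0 measure0. Qed.

Let law_ge0 A : (0 <= coin_prob A)%E. Proof. exact: measure_ge0. Qed.

Let law_sigma_additive : semi_sigma_additive coin_prob.
Proof.
move=> F mF tF mUF; rewrite /coin_prob preimage_bigcup.
apply: measure_semi_sigma_additive.
- by move=> n; rewrite -[X in measurable X]setTI; exact: measurable_digits.
- apply/trivIsetP => /= i j _ _ ij; rewrite -preimage_setI.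
  by move/trivIsetP : tF => /(_ _ _ _ _ ij) ->//; rewrite preimage_set0.
- rewrite -preimage_bigcup -[X in measurable X]setTI.
  exact: measurable_digits.
Qed.

HB.instance Definition _ := isMeasure.Build _ _ _ coin_prob
  law0 law_ge0 law_sigma_additive.

Let law_setT : coin_prob setT = 1%:E.
Proof.
rewrite /coin_prob preimage_setT /mrestr setTI /mu.
rewrite lebesgue_measure_itv /= lte_fin.
by rewrite ltr01 -EFinD subr0.
Qed.

HB.instance Definition _ :=
  Measure_isProbability.Build _ _ _ coin_prob law_setT.

Let law_prefix n (B : nat -> set bool) :
  coin_prob (\bigcap_(i in [set i | (i < n)%N]) toss i @^-1` B i) =
  (\prod_(i < n) weight (B i))%:E.
Proof.
rewrite -[X in X%:E]mul1r -(mu_cell n B 0 ler01) /coin_prob /mrestr.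
congr (mu _).
apply/seteqP; split => u.
  move=> [h]; rewrite /I01 /= in_itv /= => /andP[u0 u1].
  split=> //; first by rewrite add0r.
  by move=> i ni; rewrite subr0 divr1; exact: h.
move=> [u0 u1 h]; split; last by rewrite /I01 /= in_itv /= u0 -[1]add0r.
by move=> i ni; have := h i ni; rewrite subr0 divr1.
Qed.

Let weightT : weight setT = 1.
Proof. by rewrite /weight !in_setT addrC subrK. Qed.

Let law_bigcap (J : {fset nat}) (B : nat -> set bool) :
  coin_prob (\bigcap_(i in [set` J]) toss i @^-1` B i) =
  (\prod_(i <- J) weight (B i))%:E.
Proof.
pose n := (\max_(i <- J) i).+1.
have Jn i : i \in J -> (i < n)%N.
  by move=> iJ; rewrite ltnS; apply: (@leq_bigmax_seq _ _ xpredT id).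
pose B' i := if i \in J then B i else setT.
have -> : \bigcap_(i in [set` J]) toss i @^-1` B i =
    \bigcap_(i in [set i | (i < n)%N]) toss i @^-1` B' i.
  apply/seteqP; split => w h i /= iP.
    by rewrite /B'; case: ifP => // iJ; exact: h.
  by have := h i (Jn _ iP); rewrite /B' iP.
rewrite law_prefix; congr EFin.
transitivity (\prod_(i < n | (i : nat) \in J) weight (B i)).
  rewrite [RHS]big_mkcond /=; apply: eq_bigr => i _.
  by rewrite /B'; case: ifP.
rewrite -(big_mkord (fun i => i \in J) (fun i => weight (B i))).
rewrite -big_filter; apply: perm_big; apply: uniq_perm.
- by rewrite filter_uniq // iota_uniq.
- exact: fset_uniq.
- move=> i; rewrite mem_filter mem_index_iota /=.
  by apply/andP/idP => [[]//|iJ]; split=> //; exact: Jn.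
Qed.

Let law1 i (B : set bool) : coin_prob (toss i @^-1` B) = (weight B)%:E.
Proof.
have := law_bigcap [fset i]%fset (fun=> B).
rewrite big_seq_fset1 => <-; congr coin_prob.
apply/seteqP; split => w; first by move=> h j /=; rewrite inE => /eqP ->.
by apply; rewrite /= inE.
Qed.

Lemma coin_law_exists : exists P : probability tosses R, coin_law p P.
Proof.
exists (coin_prob : probability _ _); split=> [J B _|i].
  apply: (etrans (law_bigcap J B)); rewrite -prodEFin.
  by apply: eq_bigr => i _; exact: esym (law1 i _).
apply: (etrans (law1 i [set true])); congr EFin.
by rewrite /weight mem_set // memNset // addr0.
Qed.

End coin_law_exists.

(* Main.v *)
Require Import Defs.
From mathcomp Require Import all_boot all_order all_algebra.
From mathcomp Require Import finmap ring lra zify.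
From mathcomp Require Import all_classical all_reals all_analysis.

(** Since the first toss X_1 is a p-coin, a coin of probability 2p is obtained
    by making the event that the output is 1 twice as likely as the event that
    X_1 = 1.  Run the tosses until a stopping time N that depends only on the
    pair (n, k), where k is the number of ones among the first n tosses.  All
    words of length n with k ones have the same probability, whatever p is.
    So if at most half of the words that stop at (n, k) begin with 1, one can
    select, among the words that stop there, exactly twice as many as begin
    with 1, and output 1 on these.  Summing over (n, k) gives
    P(output = 1) = 2 P(X_1 = 1, N < oo) = 2p as soon as N < oo almost surely
    (doubling_outputs1).

    It remains to choose N such that no stopping class (n, k) contains more
    words that begin with 1 than words that begin with 0, and such that N has
    an exponential tail for p <= 1/2 - eps.  Put z = m (1 - 2k/n), where
    m eps >= 3.  The polynomial H(p) = (y - 1) (2 - y), with y = m (1 - 2p), has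
    in degree n >= 2 the Bernstein coefficients
    e(n, k) = (z - 1) (2 - z) + (m^2 - z^2) / (n - 1),
    so that C(n, k) e(n, k) satisfies the recursion of Pascal's triangle.  Stop
    at the first n > m^2 with z >= 3/2 and e(n, k) <= 0.  Let D(n, k) be the
    number of words beginning with 0 minus the number of those beginning with 1
    among the words of type (n, k) that have not stopped.  D satisfies the same
    recursion except that it is reset to 0 where the rule stops, and there
    e <= 0.  At the first time n = m^2 + 1 one has D(n, k) = C(n, k) z / m or
    D(n, k) = 0, and e <= 3 z.  Hence 3 m D(n, k) >= C(n, k) e(n, k) by
    induction (running_barrier).  A word that stops at time n + 1 > m^2 + 1
    comes from a running word with 1 <= z <= 2 or e > 0; either way e >= 0
    there, so D >= 0.  A word that stops at time m^2 + 1 has fewer ones than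
    zeros.  In both cases the stopping class is balanced in favour of 0
    (stopped_ge0).

    Finally z >= 3 forces e <= 0.  Therefore N > n > m^2 implies that more than
    a fraction 1/2 - eps/2 of the first n tosses are ones, which has
    exponentially small probability when p <= 1/2 - eps (chernoff). *)

Set Implicit Arguments.
Unset Strict Implicit.
Unset Printing Implicit Defensive.

Import Order.TTheory GRing.Theory Num.Theory.
Import numFieldNormedType.Exports.

Local Open Scope classical_set_scope.
Local Open Scope ring_scope.

(** * Words and signed counts of words *)

Fixpoint words n : seq (seq bool) :=
  if n is n'.+1 then
    map (rcons^~ false) (words n') ++ map (rcons^~ true) (words n')
  else [:: [::]].

Lemma size_word n s : s \in words n -> size s = n.
Proof.
elim: n s => [|n IHn] s; first by rewrite inE => /eqP ->.
by rewrite mem_cat => /orP[] /mapP[t /IHn tn ->]; rewrite size_rcons tn.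
Qed.

Lemma words_uniq n : uniq (words n).
Proof.
elim: n => // n IHn; rewrite cat_uniq !map_inj_uniq ?IHn //=; last first.
- by move=> s t /rcons_inj[].
- by move=> s t /rcons_inj[].
rewrite andbT; apply/hasPn => _ /mapP[s _ ->]; apply/mapP => -[t _].
by move=> /rcons_inj[].
Qed.

Lemma big_words0 (V : nmodType) (Q : pred (seq bool)) (F : seq bool -> V) :
  \sum_(s <- words 0 | Q s) F s = if Q [::] then F [::] else 0.
Proof. by rewrite big_mkcond big_seq1. Qed.

Lemma big_wordsS (V : nmodType) n (Q : pred (seq bool)) (F : seq bool -> V) :
  \sum_(s <- words n.+1 | Q s) F s =
  \sum_(s <- words n | Q (rcons s false)) F (rcons s false) +
  \sum_(s <- words n | Q (rcons s true)) F (rcons s true).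
Proof. by rewrite big_cat !big_map. Qed.

Definition ones (s : seq bool) : nat := count id s.

Lemma ones_rcons s b : ones (rcons s b) = (ones s + b)%N.
Proof. by rewrite /ones -cats1 count_cat /= addn0. Qed.

Section first_letter_sums.
Variable R : realFieldType.

(** The empty word counts as starting with 0. *)
Definition sgn (s : seq bool) : R := if head false s then -1 else 1.

Definition sgn_sum (A : pred (seq bool)) n k : R :=
  \sum_(s <- words n | A s && (ones s == k)) sgn s.

Definition pascal (f : nat -> nat -> R) n k : R :=
  f n k + (if k is k'.+1 then f n k' else 0).

(** A word of length n + 1 inherits its first letter from its prefix of length
    n, which is why signed counts obey Pascal's recursion. *)
Lemma sgn_sumS (A B : pred (seq bool)) n k (c : bool) : (0 < n)%N ->
  (forall s b, size s = n -> ones (rcons s b) = k ->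
    B (rcons s b) = A s && c) ->
  sgn_sum B n.+1 k = if c then pascal (sgn_sum A) n k else 0.
Proof.
move=> n0 AB; rewrite /sgn_sum big_wordsS /pascal.
have step b : \sum_(s <- words n | B (rcons s b) && (ones (rcons s b) == k))
    sgn (rcons s b) =
    \sum_(s <- words n | [&& A s, c & (ones s + b == k)%N]) sgn s.
  rewrite big_seq_cond [RHS]big_seq_cond; apply: eq_big => [s|s].
    have [sn|] := boolP (s \in words n) => //=.
    rewrite ones_rcons; have [k_|] := eqVneq; last by rewrite !andbF.
    by rewrite (AB s b (size_word sn)) ?ones_rcons // !andbT.
  case/and3P => sn _ _; rewrite /sgn.
  by case: s sn => // /size_word sn; rewrite -sn in n0.
rewrite !step {step}; case: c {AB} => /=; last first.
  by rewrite !big_pred0 ?addr0 // => s; rewrite andbF.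
congr (_ + _); first by apply: eq_bigl => s; rewrite addn0.
case: k => [|k]; last by apply: eq_bigl => s; rewrite addn1 eqSS.
by apply: big_pred0 => s; rewrite addn1 andbF.
Qed.

Lemma bin_left n k :
  k.+1%:R * 'C(n, k.+1)%:R = (n%:R - k%:R) * 'C(n, k)%:R :> R.
Proof.
have [kn|nk] := leqP k n; first by rewrite -natrB // -!natrM mul_bin_left.
by rewrite !bin_small ?mulr0 // ltnW.
Qed.

(** The hypotheses on f are the relations between the Bernstein coefficients of
    one polynomial in degrees n and n + 1. *)
Lemma bin_pascal (f : nat -> nat -> R) n k :
    f n.+1 0 = f n 0 ->
    (forall j, k = j.+1 ->
      (n%:R + 1) * f n.+1 j.+1 =
      (j%:R + 1) * f n j + (n%:R - j%:R) * f n j.+1) ->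
  pascal (fun n k => 'C(n, k)%:R * f n k) n k = 'C(n.+1, k)%:R * f n.+1 k.
Proof.
rewrite /pascal; case: k => [f0 _|k _ /(_ k erefl) fk].
  by rewrite !bin0 f0 addr0.
have k1 : k%:R + 1 != 0 :> R by rewrite natr1 pnatr_eq0.
rewrite binS natrD; have := bin_left n k; rewrite -natr1.
move: ('C(n, k)%:R) ('C(n, k.+1)%:R) => a b nk; apply: (mulfI k1).
transitivity ((k%:R + 1) * b * f n k.+1 + a * ((k%:R + 1) * f n k)).
  by ring.
have -> : (k%:R + 1) * f n k =
    (n%:R + 1) * f n.+1 k.+1 - (n%:R - k%:R) * f n k.+1.
  by rewrite fk; ring.
transitivity ((k%:R + 1) * b * f n.+1 k.+1 + (k%:R + 1) * a * f n.+1 k.+1).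
  by rewrite nk; ring.
by ring.
Qed.
End first_letter_sums.

(** * Words followed until a stopping rule applies *)

Section stopping.
Variable stop : nat -> nat -> bool.

Definition running (s : seq bool) : bool :=
  all (fun j => ~~ stop j (ones (take j s))) (iota 0 (size s).+1).

Definition stopped (s : seq bool) : bool :=
  all (fun j => ~~ stop j (ones (take j s))) (iota 0 (size s)) &&
  stop (size s) (ones s).

Lemma iotaSr i n : iota i n.+1 = rcons (iota i n) (i + n)%N.
Proof. by rewrite -addn1 iotaD cats1. Qed.

Let running_belast s b :
  all (fun j => ~~ stop j (ones (take j (rcons s b)))) (iota 0 (size s).+1) =
  running s.
Proof.
apply: eq_in_all => j; rewrite mem_iota add0n ltnS => js.
by rewrite -cats1 takel_cat.
Qed.

Lemma running_rcons s b : running (rcons s b) =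
  running s && ~~ stop (size s).+1 (ones (rcons s b)).
Proof.
rewrite /running size_rcons iotaSr all_rcons running_belast andbC.
by rewrite take_oversize ?size_rcons.
Qed.

Lemma stopped_rcons s b : stopped (rcons s b) =
  running s && stop (size s).+1 (ones (rcons s b)).
Proof. by rewrite /stopped size_rcons running_belast. Qed.

End stopping.

(** * A stopping rule whose stopping classes favour the first letter 0 *)

Section barrier.
Variables (R : realFieldType) (m : nat).
Hypothesis m2 : (2 <= m)%N.

(** The lead of the zeros over the ones, relative to n and scaled so that the
    barrier below changes sign near the values 1 and 2. *)
Definition lead n k : R := m%:R * (1 - 2 * (k%:R / n%:R)).

(** The degree n Bernstein coefficients of (y - 1) (2 - y) in the variable p,
    where y = m (1 - 2p). *)
Definition barrier n k : R :=
  (lead n k - 1) * (2 - lead n k) + (m%:R ^+ 2 - lead n k ^+ 2) / (n%:R - 1).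

(** The first condition keeps the correction of order 1 / n in the barrier at
    most 1.  The second one singles out the zero of the barrier near 2: the
    barrier is also negative for small leads, but a word with a negative lead is
    likely to start with 1 and must not stop. *)
Definition stop_rule n k : bool :=
  [&& (m ^ 2 < n)%N, 3 / 2 <= lead n k & barrier n k <= 0].

Let natS (n : nat) : n.+1%:R = n%:R + 1 :> R. Proof. by rewrite natr1. Qed.

(** By symmetry a word of length n with k ones starts with 1 in a fraction k / n
    of the cases. *)
Lemma sgn_sum_all n k : (0 < n)%N ->
  sgn_sum R xpredT n k = 'C(n, k)%:R * (1 - 2 * (k%:R / n%:R)).
Proof.
case: n => // n _; elim: n k => [|n IHn] k.
  rewrite /sgn_sum big_wordsS !big_words0 /sgn /=.
  by case: k => [|[|k]] //=; rewrite ?bin0 ?bin1 ?mulr0 ?addr0 ?bin_small//;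
    lra.
rewrite (@sgn_sumS _ xpredT _ _ _ true) //.
have nS (i : nat) : i%:R + 1 != 0 :> R by rewrite natr1 pnatr_eq0.
have n0 (i : nat) : 0 <= i%:R :> R by rewrite ler0n.
rewrite -(bin_pascal (f := fun n k => 1 - 2 * (k%:R / n%:R))).
- by rewrite /pascal IHn; case: k => // k; rewrite IHn.
- by rewrite !mul0r.
- move=> j _; rewrite !natS; field.
  by rewrite nS gt_eqF // addrAC; have := n0 n; lra.
Qed.

Lemma barrier_pascal n k : (2 <= n)%N ->
  pascal (fun n k => 'C(n, k)%:R * barrier n k) n k =
  'C(n.+1, k)%:R * barrier n.+1 k.
Proof.
move=> n2; have n2' : 2 <= n%:R :> R by rewrite ler_nat.
apply: bin_pascal => [|j _].
  by rewrite /barrier /lead !mul0r mulr0 subr0 mulr1 subrr !mul0r.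
rewrite /barrier /lead !natS; field.
by repeat (apply/andP; split); lra.
Qed.

Let m2' : 2 <= m%:R :> R. Proof. by rewrite ler_nat. Qed.

Let n_large n : (m ^ 2 < n)%N -> m%:R ^+ 2 <= n%:R - 1 :> R.
Proof. by move=> mn; rewrite lerBrDr -natrX natr1 ler_nat. Qed.

(** This starts the induction of running_barrier: up to the factor 3m, the
    right-hand side is the signed proportion of all words of type (n, k). *)
Lemma barrier_le n k : (m ^ 2 < n)%N -> barrier n k <= 3 * lead n k.
Proof.
have m2r := m2'; move=> /n_large mn.
have n1 : 0 < n%:R - 1 :> R by nra.
have : (m%:R ^+ 2 - lead n k ^+ 2) / (n%:R - 1) <= 1.
  rewrite ler_pdivrMr // mul1r; nra.
rewrite /barrier; nra.
Qed.

Lemma barrier_ge0 n k : (m ^ 2 < n)%N -> 1 <= lead n k <= 2 -> 0 <= barrier n k.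
Proof.
have m2r := m2'; move=> /n_large mn /andP[z1 z2]; apply: addr_ge0.
  by apply: mulr_ge0; rewrite subr_ge0.
apply: divr_ge0; nra.
Qed.

Lemma barrier_le0 n k : (m ^ 2 < n)%N -> 3 <= lead n k -> barrier n k <= 0.
Proof.
have m2r := m2'; move=> /n_large mn z3.
have n1 : 0 < n%:R - 1 :> R by nra.
have : (m%:R ^+ 2 - lead n k ^+ 2) / (n%:R - 1) <= 1.
  rewrite ler_pdivrMr // mul1r; nra.
rewrite /barrier; nra.
Qed.

Lemma stop_rule_lead n k : (m ^ 2 < n)%N -> 3 <= lead n k -> stop_rule n k.
Proof.
by move=> mn z3; rewrite /stop_rule mn barrier_le0 // andbT; lra.
Qed.

Lemma stop_ruleF n k : (n <= m ^ 2)%N -> stop_rule n k = false.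
Proof. by rewrite /stop_rule leqNgt => /negPf ->. Qed.

Lemma running_early n k : (0 < n <= m ^ 2)%N ->
  sgn_sum R (running stop_rule) n k = sgn_sum R xpredT n k.
Proof.
case/andP=> n0 nm; rewrite /sgn_sum big_seq_cond [RHS]big_seq_cond.
apply: eq_bigl => s; case: (boolP (s \in words n)) => //= /size_word sn.
rewrite (_ : running _ s) //; apply/allP => j.
rewrite mem_iota add0n ltnS sn => jn; rewrite stop_ruleF //.
exact: leq_trans jn nm.
Qed.

Let inflow n k := pascal (sgn_sum R (running stop_rule)) n k.

Lemma sgn_sum_runningS n k : (0 < n)%N ->
  sgn_sum R (running stop_rule) n.+1 k =
  if stop_rule n.+1 k then 0 else inflow n k.
Proof.
move=> n0; rewrite -if_neg; apply: sgn_sumS => // s b <- <-.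
exact: running_rcons.
Qed.

Lemma sgn_sum_stoppedS n k : (0 < n)%N ->
  sgn_sum R (stopped stop_rule) n.+1 k =
  if stop_rule n.+1 k then inflow n k else 0.
Proof.
move=> n0; apply: sgn_sumS => // s b <- <-; exact: stopped_rcons.
Qed.

Let inflow_early k : inflow (m ^ 2) k =
  'C((m ^ 2).+1, k)%:R * (1 - 2 * (k%:R / (m ^ 2).+1%:R)).
Proof.
have m0 : (0 < m ^ 2)%N by rewrite expn_gt0; lia.
rewrite -(sgn_sum_all) // (@sgn_sumS _ xpredT _ _ _ true) // /inflow /pascal.
by case: k => [|k]; rewrite !running_early ?m0 /=.
Qed.

(** Both sides satisfy Pascal's recursion, except that the right-hand side is
    reset to 0 where the rule stops; the barrier is nonpositive there, so the
    reset preserves the inequality. *)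
Lemma running_barrier n k : (m ^ 2 < n)%N ->
  'C(n, k)%:R * barrier n k <= 3 * m%:R * sgn_sum R (running stop_rule) n k.
Proof.
have m0 : (0 < m ^ 2)%N by rewrite expn_gt0; lia.
elim: n k => // n IHn k; rewrite ltnS leq_eqVlt => mn.
have n0 : (0 < n)%N by case/orP: mn => [/eqP <-|]//; lia.
rewrite sgn_sum_runningS //; case: ifP => [/and3P[_ _ b0]|_].
  by rewrite mulr0 mulr_ge0_le0.
case/orP: mn => [/eqP <-|mn].
  rewrite inflow_early mulrCA ler_wpM2l // -mulrA; exact: barrier_le.
have n2 : (2 <= n)%N by lia.
rewrite -barrier_pascal // /inflow /pascal [leRHS]mulrDr.
apply: lerD; first exact: IHn.
by case: k => [|k]; rewrite ?mulr0 // IHn.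
Qed.

(** Where the rule does not stop, a lead of at least 1 makes the barrier
    nonnegative: the lead lies in [1, 2], or it exceeds 2 and then only the sign
    of the barrier can have kept the rule from stopping. *)
Lemma running_ge0 n k : (m ^ 2 < n)%N -> 1 <= lead n k ->
  0 <= sgn_sum R (running stop_rule) n k.
Proof.
move=> mn z1; have [|ns] := boolP (stop_rule n k).
  case: n mn {z1} => // n mn ns; rewrite sgn_sum_runningS ?ns //.
  by apply: leq_trans (ltnSE mn); rewrite expn_gt0; lia.
have b0 : 0 <= barrier n k.
  have [z2|z2] := leP (lead n k) 2; first by apply: barrier_ge0; rewrite ?z1.
  have z3 : 3 / 2 <= lead n k by lra.
  by move: ns; rewrite /stop_rule mn z3 /= -ltNge => /ltW.
have m2r := m2'; have m0 : 0 < 3 * m%:R :> R by lra.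
rewrite -(pmulr_rge0 _ m0); apply: le_trans (running_barrier k mn).
exact: mulr_ge0.
Qed.

Lemma le_lead n k (c : R) : (0 < n)%N ->
  (c <= lead n k) = (c * n%:R <= m%:R * (n%:R - 2 * k%:R)).
Proof.
move=> n0; have n0' : 0 < n%:R :> R by rewrite ltr0n.
rewrite -(ler_pM2r n0') /lead -mulrA; congr (_ <= _ * _).
by field; rewrite gt_eqF.
Qed.

(** A step onto a lead of at least 3/2 raises the lead by at most m / n <= 1/2,
    so a word that stops was in the scope of running_ge0 one step before. *)
Lemma lead_pred n k : (m ^ 2 < n)%N -> 3 / 2 <= lead n.+1 k -> 1 <= lead n k.
Proof.
move=> mn; have n0 : (0 < n)%N by lia.
have nm : 2 * m%:R <= n%:R :> R by have := n_large mn; have := m2'; nra.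
rewrite !le_lead // natS; lra.
Qed.

Lemma lead_pred2 n k :
  (m ^ 2 < n)%N -> 3 / 2 <= lead n.+1 k.+1 -> 1 <= lead n k.
Proof.
move=> mn /(lead_pred mn) z1; have n0 : (0 < n)%N by lia.
by have := m2'; move: z1; rewrite !le_lead // (natS k); lra.
Qed.

(** What makes the simulation possible: at most half of the words that stop
    with given length and number of ones start with 1. *)
Lemma stopped_ge0 n k : 0 <= sgn_sum R (stopped stop_rule) n k.
Proof.
have m0 : (0 < m ^ 2)%N by rewrite expn_gt0; lia.
case: n => [|n].
  by rewrite /sgn_sum big_words0; case: (_ && _) => //; exact: ler01.
have [nm|] := ltnP n (m ^ 2).
  rewrite /sgn_sum big_seq_cond big1 // => s /andP[/size_word sn].
  by rewrite /stopped sn stop_ruleF // andbF.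
rewrite leq_eqVlt => mn.
have n0 : (0 < n)%N by case/orP: mn => [/eqP <-|]//; lia.
rewrite sgn_sum_stoppedS //; case: ifP => // /and3P[_ z _].
case/orP: mn => [/eqP mn|mn].
  rewrite -mn inflow_early; apply: mulr_ge0 => //.
  have m2r := m2'; have mgt0 : 0 < m%:R :> R by lra.
  rewrite -(pmulr_rge0 _ mgt0) mn; apply: le_trans z; lra.
rewrite /inflow /pascal addr_ge0 //.
  by apply: running_ge0 => //; exact: lead_pred.
by case: k z => // k z; apply: running_ge0 => //; exact: lead_pred2.
Qed.
End barrier.

(** * Selecting twice as many words as start with 1 *)

Section selection.
Variables (R : realFieldType) (p : R) (A : pred (seq bool)).

Definition weight (s : seq bool) : R := \prod_(b <- s) (if b then p else 1 - p).

Lemma weightE s : weight s = p ^+ ones s * (1 - p) ^+ (size s - ones s).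
Proof.
rewrite /weight /ones -(count_predC id s) addKn.
elim: s => [|b s IHs]; first by rewrite big_nil mulr1.
by rewrite big_cons IHs; case: b => /=; rewrite ?add0n exprS; ring.
Qed.

(** The probability of a set of words depends only on how many words of each
    number of ones it contains. *)
Lemma sum_weightE n :
  \sum_(s <- words n | A s) weight s = \sum_(k < n.+1)
  (count (fun s => A s && (ones s == k)) (words n))%:R *
  (p ^+ k * (1 - p) ^+ (n - k)).
Proof.
rewrite big_seq_cond.
rewrite (partition_big (fun s => inord (ones s) : 'I_n.+1) predT) //=.
apply: eq_bigr => k _; rewrite -sum1_count natr_sum mulr_suml.
rewrite [RHS]big_seq_cond; apply: eq_big => [s|s].
  case: (boolP (s \in words n)) => //= /size_word sn; congr (_ && _).
  by rewrite -val_eqE /= inordK // ltnS -sn count_size.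
case/andP=> /andP[/size_word sn _] /eqP <-.
by rewrite mul1r weightE sn inordK // ltnS -sn count_size.
Qed.
End selection.

Lemma weight_ge0 (R : realFieldType) (p : R) s : 0 <= p <= 1 -> 0 <= weight p s.
Proof.
case/andP=> p0 p1; rewrite /weight; apply: prodr_ge0 => -[] //= _.
by rewrite subr_ge0.
Qed.

Lemma weight_mgf (R : realFieldType) (p l : R) n :
  \sum_(s <- words n) weight p s * l ^+ ones s = (1 - p + p * l) ^+ n.
Proof.
have wr s b : weight p (rcons s b) = weight p s * (if b then p else 1 - p).
  by rewrite /weight -cats1 big_cat big_seq1.
elim: n => [|n IHn]; first by rewrite big_seq1 /weight big_nil mul1r.
rewrite big_wordsS exprSr -IHn mulr_suml -big_split /=.
apply: eq_bigr => s _; rewrite !wr !ones_rcons addn0 addn1 exprS; ring.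
Qed.

Definition type_class (A : pred (seq bool)) (s : seq bool) : seq (seq bool) :=
  [seq t <- words (size s) | A t && (ones t == ones s)].

(** Any subset of the type class with this number of elements would do, because
    the words of one type are equally likely; an initial segment is the
    simplest choice. *)
Definition selected (A : pred (seq bool)) (s : seq bool) : bool :=
  s \in take (2 * count (head false) (type_class A s)) (type_class A s).

Lemma count_mem_take (T : eqType) (s : seq T) n : uniq s -> (n <= size s)%N ->
  count [in take n s] s = n.
Proof.
move=> us ns; rewrite -{2}(cat_take_drop n s) count_cat.
have /eqP -> : count [in take n s] (drop n s) == 0%N.
  rewrite -leqn0 leqNgt -has_count; move: us.
  by rewrite -{1}(cat_take_drop n s) cat_uniq => /and3P[].
rewrite addn0 (eq_in_count (a2 := predT)) ?count_predT ?size_takel //.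
Qed.

Lemma sgn_sum_count (R : realFieldType) A n k : sgn_sum R A n k =
  (count (fun s => A s && (ones s == k)) (words n))%:R -
  2 * (count (fun s => A s && (ones s == k) && head false s) (words n))%:R.
Proof.
rewrite -!sum1_count !natr_sum mulr_sumr /sgn_sum [in X in _ - X]big_mkcondr /=.
rewrite -sumrB; apply: eq_bigr => s _; rewrite /sgn.
by case: (head false s) => /=; ring.
Qed.

(** The hypothesis guarantees that each type class is long enough to contain the
    segment to be selected. *)
Lemma sum_weight_selected (R : realFieldType) (p : R) A n :
    (forall k, 0 <= sgn_sum R A n k) ->
  \sum_(s <- words n | A s && selected A s) weight p s =
  2 * \sum_(s <- words n | A s && head false s) weight p s.
Proof.
move=> A0; rewrite !sum_weightE mulr_sumr; apply: eq_bigr => k _.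
rewrite [RHS]mulrA; congr (_ * _); rewrite -natrM; congr (_%:R).
set L := [seq t <- words n | A t && (ones t == k)].
have uL : uniq L by rewrite filter_uniq // words_uniq.
have cH : count (head false) L =
    count (fun s => A s && head false s && (ones s == k)) (words n).
  by rewrite count_filter; apply: eq_count => s /=; rewrite andbC andbAC.
rewrite -cH -[RHS](count_mem_take uL); last first.
  rewrite size_filter -(ler_nat R) natrM -subr_ge0.
  move: (A0 k); rewrite sgn_sum_count; congr (0 <= _ - _ * _%:R).
  by rewrite cH; apply: eq_count => s; rewrite andbAC.
rewrite [in RHS]count_filter; apply: eq_in_count => s /size_word sn /=.
rewrite andbAC [RHS]andbC; case: (boolP (A s && _)) => //= /andP[_ /eqP sk].
by rewrite /selected /type_class sn sk.
Qed.

(** * Events determined by finitely many tosses *)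

Definition prefix_event (Q : pred (seq bool)) n : set tosses :=
  [set w | Q (mkseq (toss ^~ w) n)].

Lemma prefix_eventS Q n : prefix_event Q n.+1 =
  (prefix_event (fun s => Q (rcons s true)) n `&` [set w | toss n w = true]) `|`
  (prefix_event (fun s => Q (rcons s false)) n `\` [set w | toss n w = true]).
Proof.
apply/seteqP; rewrite /prefix_event; split => w /=;
    rewrite /mkseq iotaSr map_rcons.
  by case: (toss (0 + n) w) (erefl (toss n w)) => e Qw; [left|right];
    split=> //; rewrite e.
by case=> -[Qw e]; move: Qw; [rewrite e|case: (toss n w) e].
Qed.

(** Stated for any generating family G, so that it yields both the membership in
    the filtration and the measurability. *)
Lemma sigma_prefix_event (G : set (set tosses)) n Q :
  (forall i, (i < n)%N -> <<s G >> [set w | toss i w = true]) ->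
  <<s G >> (prefix_event Q n).
Proof.
elim: n Q => [|n IHn] Q sG.
  have [Q0|Q0] := boolP (Q [::]).
    rewrite (_ : prefix_event Q 0 = setT); last by apply/seteqP; split.
    exact: (@measurableT (sigma_display G) (g_sigma_algebraType G)).
  rewrite (_ : prefix_event Q 0 = set0).
    exact: (@measurable0 (sigma_display G) (g_sigma_algebraType G)).
  by apply/seteqP; split => // w Qw; rewrite Qw in Q0.
have sn : <<s G >> [set w | toss n w = true] by exact: sG.
have IH Q' : <<s G >> (prefix_event Q' n).
  by apply: IHn => i ni; apply: sG; exact: leqW.
rewrite prefix_eventS.
apply: (@measurableU (sigma_display G) (g_sigma_algebraType G)).
- by apply: (@measurableI (sigma_display G) (g_sigma_algebraType G));
    [exact: IH|exact: sn].
- by apply: (@measurableD (sigma_display G) (g_sigma_algebraType G));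
    [exact: IH|exact: sn].
Qed.

Lemma filtration_prefix_event n Q : toss_filtration n (prefix_event Q n).
Proof.
apply: sigma_prefix_event => i ni; apply: sub_sigma_algebra.
rewrite (bigD1 (Ordinal ni)) //=; left; exists [set true] => //.
by rewrite setTI.
Qed.

Lemma measurable_toss i : measurable [set w | toss i w = true].
Proof.
apply: sub_sigma_algebra; exists i => //; exists [set true] => //.
by rewrite setTI.
Qed.

Lemma measurable_prefix_event n Q : measurable (prefix_event Q n).
Proof. by apply: sigma_prefix_event => i _; exact: measurable_toss. Qed.

Section coin.
Variables (R : realType) (p : R) (P : probability tosses R).
Hypothesis Pp : coin_law p P.

Lemma coin_toss i b : P [set w | toss i w = b] = (if b then p else 1 - p)%:E.
Proof.
case: b; first exact: (Pp.2 i).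
rewrite (_ : [set w | _] = ~` [set w | toss i w = true]).
  by rewrite probability_setC ?Pp.2 //; exact: measurable_toss.
by apply/seteqP; split => w /=; case: (toss i w).
Qed.

Lemma coin_word s : P (prefix_event (pred1 s) (size s)) = (weight p s)%:E.
Proof.
pose J := [fset i | i in iota 0 (size s)]%fset.
have -> : prefix_event (pred1 s) (size s) =
    \bigcap_(i in [set` J]) (toss i @^-1` [set nth false s i]).
  apply/seteqP; rewrite /prefix_event; split => w /=.
    move=> /eqP sw i /=; rewrite in_fset /= mem_iota add0n => si.
    by rewrite -{1}sw nth_mkseq.
  move=> sw; apply/eqP/(@eq_from_nth _ false); rewrite size_mkseq // => i si.
  by rewrite nth_mkseq // sw //= in_fset /= mem_iota.
rewrite Pp.1 // /weight (big_nth false) -prodEFin.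
have JE : perm_eq J (index_iota 0 (size s)).
  apply: uniq_perm; rewrite ?fset_uniq ?iota_uniq // => i.
  by rewrite in_fset /= /index_iota subn0.
by rewrite (perm_big _ JE); apply: eq_bigr => i _; exact: coin_toss.
Qed.

Lemma sum_words_event n (A : set tosses) : measurable A ->
  P A = (\sum_(s <- words n) P (A `&` prefix_event (pred1 s) n))%E.
Proof.
move=> mA; elim: n => [|n IHn].
  rewrite big_seq1; congr (P _); apply/seteqP; split => w; last by case.
  by move=> Aw; split.
rewrite IHn big_wordsS -big_split /=; apply: eq_bigr => s _.
rewrite (@measureDI _ _ _ P _ [set w | toss n w = true]); last 2 first.
- by apply: measurableI => //; exact: measurable_prefix_event.
- exact: measurable_toss.
by congr (P _ + P _)%E; apply/seteqP; split => w; rewrite /prefix_event /=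
    [in mkseq _ n.+1]/mkseq iotaSr map_rcons eqseq_rcons -/(mkseq _ _);
  [move=> [[Aw ->]] /negP /negPf -> |move=> [Aw /andP[-> /eqP ->]]
  |move=> [[Aw ->]] -> |move=> [Aw /andP[-> /eqP ->]]].
Qed.

Lemma coin_prefix Q n :
  P (prefix_event Q n) = (\sum_(s <- words n | Q s) weight p s)%:E.
Proof.
rewrite (@sum_words_event n); last exact: measurable_prefix_event.
rewrite -sumEFin [RHS]big_mkcond /= big_seq [RHS]big_seq.
apply: eq_bigr => s /size_word sn; case: ifPn => Qs.
  rewrite -coin_word sn; congr (P _); apply/seteqP; split => w; first by case.
  by move=> sw; split=> //; move: sw; rewrite /prefix_event /= => /eqP ->.
rewrite (_ : _ `&` _ = set0) ?measure0 //; apply/seteqP; split => w //.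
by rewrite /prefix_event /= => -[Qw /eqP e]; move: Qs; rewrite -e Qw.
Qed.
End coin.

(** * The algorithm attached to a stopping rule *)

Section first_stop.
Variable stop : nat -> nat -> bool.

Let hit (w : tosses) n := stop n (ones (mkseq (toss ^~ w) n)).

Definition first_stop (w : tosses) : option nat :=
  if pselect (exists n, hit w n) is left h then Some (ex_minn h) else None.

Let hits_before (w : tosses) n m : (n <= m.+1)%N ->
  all (fun j => ~~ stop j (ones (take j (mkseq (toss ^~ w) m)))) (iota 0 n) =
  all (fun j => ~~ hit w j) (iota 0 n).
Proof.
move=> nm; apply: eq_in_all => j; rewrite mem_iota add0n => jn.
by rewrite /mkseq -map_take take_iota (minn_idPl _) // -ltnS (leq_trans jn).
Qed.

Lemma first_stopE n :
  [set w | first_stop w = Some n] = prefix_event (stopped stop) n.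
Proof.
apply/seteqP; rewrite /prefix_event; split => w /=;
    rewrite /stopped size_mkseq hits_before // /first_stop.
  case: pselect => // h [<-]; case: ex_minnP => k hk kmin.
  apply/andP; split=> //.
  apply/allP => j; rewrite mem_iota add0n ltnNge; apply: contra; exact: kmin.
case/andP=> /allP before hn; case: pselect => [h|[]]; last by exists n.
case: ex_minnP => k hk kmin; congr Some; apply/eqP; rewrite eqn_leq kmin //=.
rewrite leqNgt; apply/negP => kn; have := before k.
by rewrite mem_iota add0n hk => /(_ kn).
Qed.

Lemma first_stopP : stopping_time first_stop.
Proof. by move=> n; rewrite first_stopE; exact: filtration_prefix_event. Qed.

Definition doubling : algorithm :=
  Algorithm first_stopP (selected (stopped stop)).

Lemma haltsE : halts doubling = \bigcup_n prefix_event (stopped stop) n.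
Proof.
apply/seteqP; split => w.
  by move=> [n nw]; exists n => //; rewrite -first_stopE.
by move=> [n _]; rewrite -first_stopE => nw; exists n.
Qed.

Lemma outputs1E : outputs1 doubling =
  \bigcup_n
    prefix_event (fun s => stopped stop s && selected (stopped stop) s) n.
Proof.
apply/seteqP; split => w.
  move=> [n nw sel]; exists n => //; apply/andP; split=> //.
  by have : [set w | first_stop w = Some n] w by []; rewrite first_stopE.
move=> [n _ /andP[st sel]]; exists n => //.
by have : prefix_event (stopped stop) n w by []; rewrite -first_stopE.
Qed.

Lemma runs_pastE n : runs_past doubling n = prefix_event (running stop) n.
Proof.
apply/seteqP; rewrite /prefix_event /runs_past; split => w /=;
    rewrite /running size_mkseq hits_before // /first_stop.
  case: pselect => [h|nh _]; last first.
    by apply/allP => j _; apply/negP => hj; case: nh; exists j.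
  case: ex_minnP => k hk kmin nk; apply/allP => j.
  rewrite mem_iota add0n ltnS => jn.
  by apply/negP => /kmin kj; move: nk; rewrite ltnNge (leq_trans kj jn).
move=> /allP before; case: pselect => // h; case: ex_minnP => k hk _.
rewrite ltnNge; apply/negP => kn; have := before k.
by rewrite mem_iota add0n ltnS hk => /(_ kn).
Qed.

Lemma trivIset_stopped (B : pred (seq bool)) :
  trivIset setT (fun n => prefix_event (fun s => stopped stop s && B s) n).
Proof.
apply/trivIsetP => i j _ _ /eqP ij; apply/seteqP; split => w //= [].
move=> /andP[si _] /andP[sj _]; apply: ij.
have : [set w | first_stop w = Some i] w by rewrite first_stopE.
have : [set w | first_stop w = Some j] w by rewrite first_stopE.
by move=> /= -> [].
Qed.

Lemma measurable_halts : measurable (halts doubling).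
Proof.
rewrite haltsE; apply: bigcupT_measurable => n.
exact: measurable_prefix_event.
Qed.

Lemma doubling_halts (R : realType) (P : probability tosses R) (C rho : R) :
    `|rho| < 1 ->
    (forall n, (P (runs_past doubling n) <= (C * rho ^+ n)%:E)%E) ->
  P (halts doubling) = 1%E.
Proof.
move=> rho1 tail; have mh := measurable_halts.
have mnh : measurable (~` halts doubling) by exact: measurableC.
have never n : (P (~` halts doubling) <= (C * rho ^+ n)%:E)%E.
  apply: le_trans (tail n); apply: le_measure; rewrite ?inE //.
    by rewrite runs_pastE; exact: measurable_prefix_event.
  move=> w nh; rewrite /runs_past /=; case E : (first_stop w) => [k|] //.
  by case: nh; exists k.
have Pfin : P (~` halts doubling) \is a fin_num by exact: fin_num_measure.
have P0 : P (~` halts doubling) = 0%E.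
  apply/eqP; rewrite eq_le measure_ge0 andbT -(fineK Pfin) lee_fin.
  rewrite -(cvg_lim (@Rhausdorff R) (cvg_geometric C rho1)); apply: limr_ge.
    exact: cvgP (cvg_geometric C rho1).
  by apply: nearW => n; rewrite -lee_fin fineK //; exact: never.
by rewrite -[halts _]setCK probability_setC // P0 sube0.
Qed.

Variables (R : realType) (p : R) (P : probability tosses R).
Hypothesis Pp : coin_law p P.
(* Stopping before any toss would prevent reading off the first one. *)
Hypothesis stop0 : stop 0 0 = false.
Hypothesis balanced : forall n k, 0 <= sgn_sum R (stopped stop) n k.

(** Among the words stopped at time n, the selected ones weigh twice as much as
    those that start with 1; summing over n turns this into twice the probability
    of the event that the first toss is 1 and the algorithm halts. *)
Lemma doubling_outputs1 : P (halts doubling) = 1%E ->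
  P (outputs1 doubling) = (2 * p)%:E.
Proof.
move=> h1.
have mh := measurable_halts.
rewrite outputs1E measure_semi_bigcup; first last.
- by apply: bigcupT_measurable => n; exact: measurable_prefix_event.
- exact: trivIset_stopped.
- by move=> n; exact: measurable_prefix_event.
pose F n := prefix_event (fun s => stopped stop s && head false s) n.
transitivity (\sum_(n <oo) (2%:E * P (F n)))%E.
  apply: eq_eseriesr => n _.
  rewrite /F [in RHS](coin_prefix Pp) -EFinM.
  apply: etrans (coin_prefix Pp _ _) _.
  congr (_%:E); exact: sum_weight_selected.
rewrite nneseriesZl // -measure_semi_bigcup; first last.
- by apply: bigcupT_measurable => n; exact: measurable_prefix_event.
- exact: trivIset_stopped.
- by move=> n; exact: measurable_prefix_event.
have -> : \bigcup_n F n = [set w | toss 0 w = true] `&` halts doubling.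
  rewrite haltsE setI_bigcupr; apply: eq_bigcupr => n _.
  apply/seteqP; rewrite /F /prefix_event; split => w /=.
    by case: n => [|n] /andP[st hd].
  by case=> w0 st; rewrite st; case: n st => //; rewrite /stopped /= stop0.
rewrite EFinM -(coin_toss Pp 0 true); congr (_ * _)%E.
have mt := measurable_toss 0.
rewrite [RHS](measureDI P mt mh) [X in (X + _)%E](_ : _ = 0%E) ?add0e //.
apply/eqP; rewrite -measure_le0.
have <- : P (~` halts doubling) = 0%E by rewrite probability_setC // h1 subee.
apply: le_measure; rewrite ?inE; [exact: measurableD|exact: measurableC|].
by move=> w [].
Qed.
End first_stop.

(** * Exponential tails *)

(** Exponential Markov inequality.  Any tilt l > 1 with p l < x works: with
    u = ln l >= (l - 1) / l one gets p (l - 1) < u x, hence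
    1 - p + p l <= exp (p (l - 1)) < exp (u x). *)
Lemma chernoff (R : realType) (p x : R) : 0 <= p <= 1 -> p < x ->
  exists rho : R, 0 < rho < 1 /\ forall n,
    \sum_(s <- words n | x * n%:R <= (ones s)%:R) weight p s <= rho ^+ n.
Proof.
move=> p01 px; have /andP[p0 p1] := p01.
have px0 : 0 < p + x by lra.
have [l l1 pl] : exists2 l, 1 < l & p * l < x.
  (* p l / x is 2p / (p + x), which is below 1 because p < x. *)
  exists (2 * x / (p + x)); first by rewrite ltr_pdivlMr //; lra.
  by rewrite mulrA ltr_pdivrMr //; nra.
have l0 : 0 < l by lra.
have [u u0 lE] : exists2 u : R, 0 < u & l = expR u.
  by exists (ln l); rewrite ?ln_gt0 // lnK.
have u_ge : l - 1 <= u * l.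
  have := expR_ge1Dx (- u); rewrite expRN -lE.
  rewrite -(ler_pM2r l0) mulVf ?gt_eqF //; nra.
have q0 : 0 < 1 - p + p * l by nra.
exists ((1 - p + p * l) * expR (- (u * x))); split=> [|n].
  rewrite mulr_gt0 ?expR_gt0 //= -[ltRHS]expR0.
  apply: (@le_lt_trans _ _ (expR (p * (l - 1)) * expR (- (u * x)))).
    rewrite ler_pM2r ?expR_gt0 //; apply: le_trans (expR_ge1Dx _); lra.
  rewrite -expRD ltr_expR; nra.
rewrite exprMn -weight_mgf mulr_suml big_mkcond; apply: ler_sum => s _.
have w0 := weight_ge0 s p01.
case: ifP => [xn|_]; last by rewrite !mulr_ge0 ?exprn_ge0 ?expR_ge0 // ltW.
rewrite -mulrA ler_peMr // lE -!expRM_natl -expRD -[leLHS]expR0 ler_expR; nra.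
Qed.

Theorem theorem1 (R : realType) (eps : R) (eps_gt0 : 0 < eps) :
  has_fast_simulation `[0, 1 / 2 - eps]%classic (fun p : R => 2 * p).
Proof.
pose m := (Num.bound (3 / eps)).+2.
have m3 : 3 <= m%:R * eps.
  rewrite -ler_pdivrMr //; apply: le_trans (ltW (archi_boundP _)) _.
    by apply: divr_ge0 => //; exact: ltW.
  by rewrite ler_nat /m; exact: leqW (leqnSn _).
have m2 : (2 <= m)%N by [].
pose A := doubling (@stop_rule R m).
have tail p : `[0, 1 / 2 - eps]%classic p -> exists C rho : R,
    [/\ 0 < C, 0 < rho < 1 & forall P : probability tosses R, coin_law p P ->
      forall n, (P (runs_past A n) <= (C * rho ^+ n)%:E)%E].
  rewrite /= in_itv /= => /andP[p0 pe].
  have p01 : 0 <= p <= 1 by rewrite p0 /=; lra.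
  have px : p < 1 / 2 - eps / 2 by lra.
  have [rho [/andP[r0 r1] Hrho]] := chernoff p01 px.
  have C1 : 1 <= rho^-1 ^+ (m ^ 2) by rewrite exprn_ege1 // invf_ge1 // ltW.
  (* The constant makes the bound trivial up to time m ^ 2, until which
     the rule never stops. *)
  exists (rho^-1 ^+ (m ^ 2)), rho; split; rewrite ?r0 //; first by lra.
  move=> P Pp n; rewrite runs_pastE.
  have [nm|mn] := leqP n (m ^ 2).
    apply: le_trans (probability_le1 P (measurable_prefix_event n _)) _.
    rewrite lee_fin -(subnK nm) exprD -mulrA -exprMn mulVf ?gt_eqF //.
    rewrite expr1n mulr1.
    by rewrite exprn_ege1 // invf_ge1 // ltW.
  rewrite (coin_prefix Pp) lee_fin.
  apply: le_trans (_ : rho ^+ n <= _); last first.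
    by rewrite ler_peMl // exprn_ge0 // ltW.
  apply: le_trans (Hrho n).
  rewrite big_seq_cond [leLHS]big_mkcond [leRHS]big_mkcond /=.
  apply: ler_sum => s _.
  case: ifP => [/andP[/size_word sn run]|_]; last first.
    by case: ifP => // _; exact: weight_ge0.
  rewrite ifT //; have n0 : (0 < n)%N by lia.
  have : ~~ stop_rule R m n (ones s).
    move: run; rewrite /running iotaSr all_rcons => /andP[+ _].
    by rewrite add0n take_oversize // sn.
  apply: contraNT; rewrite -ltNge => small; apply: stop_rule_lead => //.
  rewrite le_lead //; have : 0 <= m%:R :> R by [].
  have : 0 < n%:R :> R by rewrite ltr0n.
  nra.
exists A; split; last first.
  move=> p Sp; have [C [rho [C0 /andP[_ r1] H]]] := tail p Sp.
  by exists C, rho; split.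
move=> p Sp P Pp; have [C [rho [C0 /andP[r0 r1] H]]] := tail p Sp.
suff h1 : P (halts A) = 1%E.
  split=> //; apply: (doubling_outputs1 Pp) => // n k.
  exact: stopped_ge0.
by apply: (doubling_halts _ (H P Pp)); rewrite ger0_norm // ltW.
Qed.
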